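(* For every constant $c\ge 1$ there is a constant $C>0$ (depending only on $c$) such that every graph $G=(V,E)$ with $n=|V|\ge 2$ vertices, minimum degree $\delta$ and maximum degree $\Delta\le c\,\delta$ satisfies $$\mathcal{R}(G)\;\ge\; C\cdot\frac{\sqrt{n}}{\sqrt{\delta}}\cdot\frac{1}{\log n}.$$
   Context: Graphs are finite, undirected, simple and connected. A random walk on $G$ moves at each step from its current vertex to a neighbor chosen uniformly at random. The cover time $\mathsf{COV}(s)$ is the expected number of steps for the walk started at $s$ to visit all vertices, and $\mathsf{COV}(G)=\max_{s\in V}\mathsf{COV}(s)$. Randomized broadcast algorithm $\mathsf{RBA}$ (push algorithm): at time $0$ only a vertex $s$ knows a rumor; at each time step $t=1,2,\dots$ every vertex that knows the rumor chooses, independently, a neighbor uniformly at random and informs it. $I_t$ is the set of informed vertices at time $t$ ($I_0=\{s\}$). The expected broadcast time is $\mathbf{E}[\mathsf{RBA}(G)]:=\max_{s\in V}\mathbf{E}[\min\{t: I_t=V\}\text{ with } I_0=\{s\}]$. Finally $\mathcal{R}(G):=\mathsf{COV}(G)/\mathbf{E}[\mathsf{RBA}(G)]$. *)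

(* Defs.v *)
From HB Require Import structures.
From mathcomp Require Import all_boot all_order all_algebra.
From mathcomp Require Import all_classical all_reals all_analysis.

Set Implicit Arguments.
Unset Strict Implicit.
Unset Printing Implicit Defensive.
Import Order.TTheory GRing.Theory Num.Theory.
Local Open Scope ring_scope.

Record simple_connected (V : finType) (e : rel V) : Prop := SimpleConnected {
  sc_sym : symmetric e;
  sc_irr : irreflexive e;
  sc_conn : forall x y, connect e x y
}.

Definition deg (V : finType) (e : rel V) (v : V) : nat := #|[set u | e v u]|.

Definition maxdeg (V : finType) (e : rel V) : nat := (\max_(v : V) deg e v)%N.

(* The default #|V| exceeds every degree of a loopless graph, so for nonempty V
   it does not affect the minimum. *)
Definition mindeg (V : finType) (e : rel V) : nat :=
  (\big[minn/#|V|]_(v : V) deg e v)%N.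

(* Probability that a neighbor of v chosen uniformly at random is u. *)
Definition step (R : realType) (V : finType) (e : rel V) (v u : V) : R :=
  if e v u then (deg e v)%:R^-1 else 0.

Definition first_time (Q : pred nat) (t : nat) : bool :=
  Q t && [forall i : 'I_t, ~~ Q i].

(* Expectation of a random time T with values in {0, 1, 2, ...} U {+oo} and
   Pr[T = t] = p t; the mass missing from p is that of {T = +oo}.  Recall that
   0 * +oo = 0 in \bar R. *)
Definition expected_time (R : realType) (p : nat -> R) : \bar R :=
  (\sum_(0 <= t <oo) (t%:R * p t)%:E +
   (1 - \sum_(0 <= t <oo) (p t)%:E) * +oo)%E.

Section RandomWalk.
Variables (R : realType) (V : finType) (e : rel V).

(* Probability that the walk started at s continues with the vertices of w. *)
Fixpoint walk_prob (s : V) (w : seq V) : R :=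
  if w is u :: w' then step R e s u * walk_prob u w' else 1.

Definition visited_all (s : V) (w : seq V) (i : nat) : bool :=
  [forall v : V, v \in s :: take i w].

Definition cover_time_law (s : V) (t : nat) : R :=
  \sum_(w : t.-tuple V | first_time (visited_all s w) t) walk_prob s w.

Definition COV_from (s : V) : \bar R := expected_time (cover_time_law s).

Definition COV : \bar R := \big[maxe/-oo%E]_(s : V) COV_from s.

End RandomWalk.

(* One round of RBA is recorded by a map f : V -> V, where f v is the neighbor
   chosen by v.  For uniformity a choice is also drawn for uninformed vertices,
   but it has no effect on who is informed. *)
Section RandomizedBroadcast.
Variables (R : realType) (V : finType) (e : rel V).

Definition push (I : {set V}) (f : {ffun V -> V}) : {set V} :=
  I :|: [set f v | v in I].

Definition informed (s : V) (fs : seq {ffun V -> V}) (i : nat) : {set V} :=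
  foldl push [set s] (take i fs).

(* All choices are independent, across vertices and across rounds. *)
Definition choices_prob (fs : seq {ffun V -> V}) : R :=
  \prod_(f <- fs) \prod_(v : V) step R e v (f v).

Definition broadcast_time_law (s : V) (t : nat) : R :=
  \sum_(fs : t.-tuple {ffun V -> V}
        | first_time (fun i => informed s fs i == [set: V]) t) choices_prob fs.

Definition RBA_from (s : V) : \bar R := expected_time (broadcast_time_law s).

Definition RBA : \bar R := \big[maxe/-oo%E]_(s : V) RBA_from s.

End RandomizedBroadcast.

Definition cover_broadcast_ratio (R : realType) (V : finType) (e : rel V) :
  \bar R := (COV R e / RBA R e)%E.

(* Main.v *)
(* Let D be the maximum degree.  Replace the broadcast from s by a deterministic
   process in which every active vertex sends one unit per round to each
   neighbour and a vertex becomes active once it has received D units; let f be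
   the activation times and F their maximum.

   Upper bound on RBA.  Slow the deterministic schedule down by a factor L.  If
   y is the first vertex to be late, then no neighbour x of y chose y in rounds
   [L f(x), L f(y)); these are at least L D independent chances of at least 1/D
   each, so this has probability at most 2^-L.  A union bound over y gives
   Pr[T > L F] <= n 2^-L, hence E[T] = O(F log n).

   Lower bound on COV.  For every y, the sum of f(y) - 1 - f(x) over the earlier
   neighbours x is less than D, so the Dirichlet energy of f is O(n D^2).  By
   the commute time identity and Cauchy-Schwarz, the commute time between s and
   the last activated vertex is at least of order |E| F^2 / (n D^2), which is of
   order F^2 / delta.  Together with COV >= n - 1 and max(a, b) >= sqrt(a b)
   this gives COV >= const * F * sqrt(n / delta). *)
Require Import Defs.
From HB Require Import structures.
From mathcomp Require Import all_boot all_order all_algebra.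
From mathcomp Require Import all_classical all_reals all_analysis.
From mathcomp Require Import zify ring lra.
Import Order.TTheory GRing.Theory Num.Theory.
Set Implicit Arguments.
Unset Strict Implicit.
Unset Printing Implicit Defensive.
Local Open Scope ring_scope.

(** * Expectation of a random time as the sum of its survival function *)

Section ExpectedTime.
Variables (R : realType).

Lemma nneseries_le_bound (u : nat -> R) (x : R) :
  (forall t, 0 <= u t) -> (forall N, \sum_(0 <= t < N) u t <= x) ->
  (\sum_(0 <= t <oo) (u t)%:E <= x%:E)%E.
Proof.
move=> u0 ux; apply: lime_le.
  by apply: is_cvg_nneseries => t _ _; rewrite lee_fin.
by apply: nearW => N; rewrite sumEFin lee_fin.
Qed.

Lemma nneseries_ge_partial (u : nat -> R) (N : nat) :
  (forall t, 0 <= u t) ->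
  ((\sum_(0 <= t < N) u t)%:E <= \sum_(0 <= t <oo) (u t)%:E)%E.
Proof.
move=> u0; rewrite -sumEFin; apply: nneseries_lim_ge => t _ _.
by rewrite lee_fin.
Qed.

(* [a t] is the survival probability Pr[T > t] and [p] the law of [T]. *)
Variables (a p : nat -> R).
Hypotheses (a_ge0 : forall t, 0 <= a t) (a_dec : forall t, a t.+1 <= a t).
Hypotheses (a_le1 : a 0 <= 1) (p_0 : p 0 = 1 - a 0).
Hypothesis p_S : forall t, p t.+1 = a t - a t.+1.

Let p_ge0 t : 0 <= p t.
Proof. by case: t => [|t]; rewrite ?p_0 ?p_S subr_ge0. Qed.

Let tp_ge0 t : 0 <= t%:R * p t.
Proof. by rewrite mulr_ge0. Qed.

Let a_anti m n : (m <= n)%N -> a n <= a m.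
Proof.
elim: n => [|n IH]; first by rewrite leqn0 => /eqP->.
rewrite leq_eqVlt => /predU1P[->//|]; rewrite ltnS => /IH; exact: le_trans.
Qed.

Let psum N : \sum_(0 <= t < N.+1) p t = 1 - a N.
Proof.
elim: N => [|N IH]; first by rewrite big_nat1.
by rewrite big_nat_recr //= IH p_S addrA subrK.
Qed.

Let tpsum N :
  \sum_(0 <= t < N.+1) t%:R * p t = \sum_(0 <= t < N) a t - N%:R * a N.
Proof.
elim: N => [|N IH]; first by rewrite big_nat1 big_geq // !mul0r subr0.
by rewrite big_nat_recr //= IH p_S [in RHS]big_nat_recr //= -natr1; ring.
Qed.

Let psum_le1 N : \sum_(0 <= t < N) p t <= 1.
Proof.
case: N => [|N]; first by rewrite big_geq.
by rewrite psum gerBl.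
Qed.

(** As [a] decreases and its partial sums are at most [B], [a N <= B / N.+1] tends to 0. So [p] has
    total mass 1, the infinite term vanishes, and summation by parts ([tpsum]) bounds the rest. *)
Lemma expected_time_le (B : R) :
  (forall N, \sum_(0 <= t < N) a t <= B) -> (expected_time p <= B%:E)%E.
Proof.
move=> aB.
have S1 := nneseries_le_bound p_ge0 psum_le1.
have aN N : a N <= B / N.+1%:R.
  rewrite ler_pdivlMr // (le_trans _ (aB N.+1)) //.
  rewrite -[N.+1 in X in X <= _]subn0 mulr_natr -sumr_const_nat.
  by apply: ler_sum_nat => i /andP[_]; rewrite ltnS; apply: a_anti.
have B0 : 0 <= B by have := aB 0; rewrite big_geq.
rewrite /expected_time.
have -> : (\sum_(0 <= t <oo) (p t)%:E = 1)%E.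
  apply: le_anti; rewrite S1 /=.
  have Sge N := nneseries_ge_partial N p_ge0.
  move: S1 Sge; case: (limn _) => [r| |] // _ Sge; last by have := Sge 0.
  rewrite lee_fin leNgt; apply/negP => r1.
  (* If the total mass [r] were below 1, every [a k] would be at least [1 - r]; this index makes
     [B / k.+1] smaller than that. *)
  have := Sge (Num.bound (B / (1 - r))).+1; rewrite psum lee_fin.
  have := aN (Num.bound (B / (1 - r))); set k := Num.bound _ => ak rk.
  have r1' : 0 < 1 - r by rewrite subr_gt0.
  have : B / (1 - r) < k%:R by rewrite archi_boundP // divr_ge0 // ltW.
  rewrite ltr_pdivrMr // => Bk.
  have : 1 - r <= B / k.+1%:R by apply: le_trans ak; lra.
  rewrite ler_pdivlMr // -natr1 mulrDr mulr1 => h.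
  have h2 : k%:R * (1 - r) = (1 - r) * k%:R by rewrite mulrC.
  lra.
rewrite subee // mul0e adde0.
apply: nneseries_le_bound => // N.
case: N => [|N]; first by rewrite big_geq.
by rewrite tpsum (le_trans _ (aB N)) // gerBl mulr_ge0.
Qed.

(** Missing mass makes the expectation infinite. With full mass, an expectation below the partial
    sum would, by summation by parts, keep [a M] above a fixed [d > 0] for all [M >= N], so the mass
    would be at most [1 - d]. *)
Lemma expected_time_ge (N : nat) :
  ((\sum_(0 <= t < N) a t)%:E <= expected_time p)%E.
Proof.
rewrite /expected_time.
have S1 := nneseries_le_bound p_ge0 psum_le1.
have Sge k := nneseries_ge_partial k p_ge0.
have Xge k := nneseries_ge_partial k tp_ge0.
have S_le := @nneseries_le_bound p _ p_ge0.
move: S1 Sge S_le; case: (limn (fun n => \sum_(0 <= k < n) (p k)%:E)%E) => [r| |] // S1 Sge S_le; last first.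
  by have := Sge 0.
have X0 : (0 <= \sum_(0 <= t <oo) (t%:R * p t)%:E)%E.
  by apply: nneseries_ge0 => t _ _; rewrite lee_fin.
rewrite lee_fin in S1.
move: S1; rewrite le_eqVlt => /predU1P[r1|r1]; last first.
  rewrite -EFinB gt0_muley ?lte_fin ?subr_gt0 // addey ?leey //.
  by rewrite -ltNye (lt_le_trans _ X0).
rewrite r1 subee // mul0e adde0.
move: Xge X0; case: (limn _) => [x| |] // Xge _; last by rewrite leey.
rewrite lee_fin leNgt; apply/negP => xs.
case: (posnP N) => [N0|N0].
  by move: xs (Xge 0); rewrite N0 !big_geq // lee_fin leNgt => ->.
have aM M : (N <= M)%N -> (\sum_(0 <= t < N) a t - x) / N%:R <= a M.
  move=> NM; rewrite ler_pdivrMr ?ltr0n //.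
  have := Xge M.+1; rewrite lee_fin tpsum (@big_cat_nat _ _ _ N) //=.
  have : (M - N)%:R * a M <= \sum_(N <= t < M) a t.
    rewrite mulr_natl -sumr_const_nat.
    by apply: ler_sum_nat => i /andP[_ /ltnW]; apply: a_anti.
  rewrite natrB // mulrBl [a M * _]mulrC; lra.
set d := (_ / _) in aM.
have d0 : 0 < d by rewrite divr_gt0 ?ltr0n // subr_gt0.
have : (r%:E <= (1 - d)%:E)%E.
  apply: S_le => k; apply: (@le_trans _ _ (\sum_(0 <= t < (maxn N k).+1) p t)).
    have kM : (k <= (maxn N k).+1)%N by apply/leqW/leq_maxr.
    by rewrite (@big_cat_nat _ _ _ k 0%N (maxn N k).+1) //= lerDl sumr_ge0.
  by rewrite psum lerD2l lerN2 aM // leq_maxl.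
by rewrite lee_fin r1; lra.
Qed.

End ExpectedTime.

(** * Stopping laws of weighted random words, common to the walk and the broadcast *)

Section StoppingLaw.
Variables (R : realType) (T : finType) (W : seq T -> R) (P : pred (seq T)).
Hypotheses (W_ge0 : forall w, 0 <= W w) (W_nil : W [::] = 1).
Hypothesis W_rcons : forall w, \sum_u W (rcons w u) = W w.
Hypothesis P_rcons : forall w u, P w -> P (rcons w u).

Lemma sum_rcons_tuple (G : seq T -> R) t :
  \sum_(w : t.+1.-tuple T) G w = \sum_(w : t.-tuple T) \sum_u G (rcons w u).
Proof.
rewrite pair_big /=.
rewrite (reindex (fun wu : t.-tuple T * T => [tuple of rcons wu.1 wu.2])) //=.
pose inv (w : t.+1.-tuple T) :=
  ([tuple of belast (thead w) (behead w)], last (thead w) (behead w)).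
exists inv => [[w u] _ | w _].
  congr pair; last by case: w => -[|x w] //= ?; rewrite last_rcons.
  by apply: val_inj => /=; case: w => -[|x w] //= ?; rewrite belast_rcons.
apply: val_inj => /=; case/tupleP: w => x w /=.
by rewrite theadE -lastI.
Qed.

Definition survival (t : nat) : R := \sum_(w : t.-tuple T | ~~ P w) W w.

Definition stop_law (t : nat) : R :=
  \sum_(w : t.-tuple T | first_time (fun i => P (take i w)) t) W w.

Lemma sum_weight t : \sum_(w : t.-tuple T) W w = 1.
Proof.
elim: t => [|t IH].
  rewrite (big_pred1 [tuple]) // => w; apply/esym/eqP/val_inj.
  by rewrite tuple0.
by rewrite sum_rcons_tuple; under eq_bigr do rewrite W_rcons.
Qed.

Lemma survival_ge0 t : 0 <= survival t.
Proof. exact: sumr_ge0. Qed.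

Lemma survival_le1 t : survival t <= 1.
Proof.
by rewrite -(sum_weight t) /survival big_mkcond; apply: ler_sum => w _; case: ifP.
Qed.

Lemma prefix_pred w i j : (i <= j)%N -> P (take i w) -> P (take j w).
Proof.
move=> ij Pi; elim: j ij => [|j IH]; first by rewrite leqn0 => /eqP <-.
rewrite leq_eqVlt => /predU1P[<-//|]; rewrite ltnS => /IH Pj.
have [jw|wj] := ltnP j (size w); last by rewrite !take_oversize ?leqW // in Pj *.
by case: w {IH Pi} jw Pj => // x w jw; rewrite (take_nth x jw); apply: P_rcons.
Qed.

Lemma first_timeE t (w : seq T) : first_time (fun i => P (take i w)) t.+1 =
  P (take t.+1 w) && ~~ P (take t w).
Proof.
rewrite /first_time; congr andb; apply/forallP/idP => [/(_ ord_max)//|nP i].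
by apply: contra nP; apply: prefix_pred; rewrite -ltnS.
Qed.

(** The event depends only on the first [t] letters, so the last letter is summed out by
    [W_rcons]. *)
Lemma survival_split t :
  \sum_(w : t.+1.-tuple T | ~~ P (take t w)) W w = survival t.
Proof.
rewrite big_mkcond /=.
rewrite (sum_rcons_tuple (fun w => if ~~ P (take t w) then W w else 0)).
rewrite /survival [RHS]big_mkcond; apply: eq_bigr => w _.
rewrite -[in RHS]W_rcons.
under eq_bigr do rewrite -cats1 take_size_cat ?size_tuple // cats1.
by case: ifP => // _; rewrite big1.
Qed.

Lemma stop_law0 : stop_law 0 = 1 - survival 0.
Proof.
rewrite -(sum_weight 0) (bigID (fun w : 0.-tuple T => P w)) /= addrK.
apply: eq_bigl => w; rewrite /first_time tuple0 /=.
by apply/andb_idr => _; apply/forallP => -[].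
Qed.

Lemma stop_lawS t : stop_law t.+1 = survival t - survival t.+1.
Proof.
rewrite -survival_split (bigID (fun w : t.+1.-tuple T => P w)) /=.
rewrite (_ : \sum_(w : t.+1.-tuple T | ~~ P (take t w) && ~~ P w) W w =
             survival t.+1).
  rewrite addrK; apply: eq_bigl => w.
  by rewrite first_timeE take_oversize ?size_tuple // andbC.
apply: eq_bigl => w; apply/andb_idl; apply: contra.
by rewrite -{2}(take_size w); apply: prefix_pred; rewrite size_tuple.
Qed.

Lemma survival_dec t : survival t.+1 <= survival t.
Proof. by rewrite -subr_ge0 -stop_lawS sumr_ge0. Qed.

Lemma stop_time_le (B : R) :
  (forall N, \sum_(0 <= t < N) survival t <= B) ->
  (expected_time stop_law <= B%:E)%E.
Proof.
apply: expected_time_le stop_law0 stop_lawS B.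
- exact: survival_ge0.
- exact: survival_dec.
- exact: survival_le1.
Qed.

Lemma stop_time_ge (N : nat) :
  ((\sum_(0 <= t < N) survival t)%:E <= expected_time stop_law)%E.
Proof.
apply: expected_time_ge stop_law0 stop_lawS N.
- exact: survival_ge0.
- exact: survival_dec.
- exact: survival_le1.
Qed.

End StoppingLaw.

(** * Activation times of the deterministic process *)

(* Deterministic counterpart of the broadcast: a vertex becomes active once it
   has collected [D] units, receiving one unit per round from each active
   neighbour; [f] records the activation times. *)
Section Activation.
Variables (V : finType) (e : rel V) (s : V) (D : nat).
Hypotheses (e_sym : symmetric e) (e_conn : forall x y, connect e x y).
Hypothesis D_gt0 : (0 < D)%N.

Fixpoint units (t : nat) (y : V) : nat :=
  if t is t'.+1 then (units t' y + \sum_(x | e y x) (D <= units t' x))%N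
  else D * (y == s).

Lemma units_mono t1 t2 y : (t1 <= t2)%N -> (units t1 y <= units t2 y)%N.
Proof.
elim: t2 => [|t2 IH]; first by rewrite leqn0 => /eqP->.
rewrite leq_eqVlt => /predU1P[->//|]; rewrite ltnS => /IH /leq_trans-> //.
by rewrite /= leq_addr.
Qed.

Lemma units_edge t k x y : e x y -> (D <= units t x)%N -> (k <= units (t + k) y)%N.
Proof.
move=> exy Dx; elim: k => [//|k IH].
rewrite addnS /= -addn1 leq_add // (bigD1 x) /=; last by rewrite e_sym.
by rewrite (leq_trans Dx) ?leq_addr // units_mono // leq_addr.
Qed.

(** Induction along a path from [s]: an active vertex alone activates its neighbor within [D]
    further rounds. *)
Lemma units_active y : exists t, (D <= units t y)%N.
Proof.
have /connectP[p] := e_conn s y; elim/last_ind: p y => [|p z IH] y.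
  by move=> _ ->; exists 0%N; rewrite /= eqxx muln1.
rewrite rcons_path last_rcons => /andP[ep ez] ->.
have [t Dt] := IH _ ep erefl.
by exists (t + D)%N; apply: units_edge ez Dt.
Qed.

Definition activation (y : V) : nat := ex_minn (units_active y).

Lemma activation_leE t y : (activation y <= t)%N = (D <= units t y)%N.
Proof.
rewrite /activation; case: ex_minnP => m Dm mmin.
apply/idP/idP => [mt|/mmin//]; exact: leq_trans Dm (units_mono _ mt).
Qed.

Lemma activation_source : activation s = 0%N.
Proof. by apply/eqP; rewrite -leqn0 activation_leE /= eqxx muln1. Qed.

(** Each neighbor has sent one unit per round since its activation; truncated subtraction gives 0
    before that. The source is excluded because of its initial [D] units. *)
Lemma unitsE t y : y != s -> units t y = (\sum_(x | e y x) (t - activation x))%N.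
Proof.
move=> ys; elim: t => [|t IH]; first by rewrite /= (negbTE ys) muln0 big1.
rewrite /= IH -big_split /=; apply: eq_bigr => x _.
by rewrite -activation_leE; case: leqP; lia.
Qed.

Lemma activation_ge y : y != s ->
  (D <= \sum_(x | e y x) (activation y - activation x))%N.
Proof. by move=> ys; rewrite -unitsE // -activation_leE. Qed.

(** One round before its activation [y] holds fewer than [D] units. If [y] is active at time 0, all
    truncated differences are 0. *)
Lemma activation_lt y :
  (\sum_(x | e y x) (activation y - 1 - activation x) < D)%N.
Proof.
have [->|ys] := eqVneq y s.
  by rewrite activation_source big1.
case: (posnP (activation y)) => [->|y0]; first by rewrite big1.
by rewrite -unitsE // ltnNge -activation_leE; lia.
Qed.

Lemma activation_eq0 y : (activation y == 0%N) = (y == s).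
Proof.
by rewrite -leqn0 activation_leE /=; case: eqP; rewrite ?muln1 ?muln0 ?leqnn // leqNgt D_gt0.
Qed.

(** The share of the Dirichlet energy charged to the later endpoint [y]. A sum of squares is at most
    the square of the sum, bounded by [activation_lt]; the shift by one round costs
    [(a + 1)^2 <= 2 a^2 + 2]. *)
Lemma activation_sqr y :
  (\sum_(x | e y x && (activation x < activation y))
     (activation y - activation x) ^ 2 <= 2 * D ^ 2 + 2 * deg e y)%N.
Proof.
have sq (P : pred V) (G : V -> nat) :
    (\sum_(x | P x) G x ^ 2 <= (\sum_(x | P x) G x) ^ 2)%N.
  rewrite -[in leqRHS]mulnn big_distrl /=; apply: leq_sum => x Px.
  by rewrite -mulnn leq_mul2l (bigD1 x) // leq_addr orbT.
apply: (@leq_trans (\sum_(x | e y x)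
    (2 * (activation y - 1 - activation x) ^ 2 + 2))%N).
  rewrite big_mkcondr; apply: leq_sum => x _.
  case: ifP => // xy.
  have -> : (activation y - activation x = (activation y - 1 - activation x).+1)%N by lia.
  by rewrite -!mulnn; nia.
rewrite big_split /= -big_distrr /= sum_nat_const leq_add //.
  rewrite leq_mul2l /= (leq_trans (sq _ _)) // leq_exp2r // ltnW //.
  exact: activation_lt.
by rewrite mulnC leq_mul2l /= /deg cardsE.
Qed.

End Activation.

(** * Laplacian, Dirichlet energy and commute times *)

Section Laplacian.
Variables (R : realType) (V : finType) (e : rel V).
Hypotheses (e_sym : symmetric e) (e_conn : forall x y, connect e x y).

Definition lap (g : V -> R) (x : V) : R := \sum_(y | e x y) (g x - g y).

Definition energy (f g : V -> R) : R :=
  \sum_x \sum_(y | e x y) (f x - f y) * (g x - g y).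

(** Summation by parts; the factor 2 appears because [energy] runs over ordered pairs and so counts
    each edge twice. *)
Lemma energyE f g : energy f g = 2 * \sum_x f x * lap g x.
Proof.
have swap : \sum_x \sum_(y | e x y) f y * (g y - g x) = \sum_x f x * lap g x.
  under eq_bigr do rewrite big_mkcond /=.
  rewrite exchange_big /=; apply: eq_bigr => y _.
  by rewrite -big_mkcond /= /lap mulr_sumr; apply: eq_bigl => x; rewrite e_sym.
rewrite mulr2n mulrDl mul1r -{2}swap -big_split; apply: eq_bigr => x _.
by rewrite /lap mulr_sumr -big_split; apply: eq_bigr => y _ /=; ring.
Qed.

Lemma sum_lap g : \sum_x lap g x = 0.
Proof.
have := energyE (fun=> 1) g; rewrite /energy.
rewrite big1 => [|x _]; last by apply: big1 => y _; rewrite subrr mul0r.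
under [X in _ = _ * X]eq_bigr do rewrite mul1r.
by move/esym/eqP; rewrite mulf_eq0 pnatr_eq0 /= => /eqP.
Qed.

Lemma energy_ge0 f : 0 <= energy f f.
Proof. by rewrite sumr_ge0 // => x _; rewrite sumr_ge0 // => y _; rewrite -expr2 sqr_ge0. Qed.

Lemma energy_cauchy_schwarz f g : energy f g ^+ 2 <= energy f f * energy g g.
Proof.
have quad (l : R) : 0 <= energy f f - 2 * l * energy f g + l ^+ 2 * energy g g.
  have := energy_ge0 (fun x => f x - l * g x).
  congr (_ <= _); rewrite /energy !mulr_sumr -sumrB -big_split /=.
  apply: eq_bigr => x _; rewrite !mulr_sumr -sumrB -big_split /=.
  by apply: eq_bigr => y _; ring.
have g0 := energy_ge0 g; have f0 := energy_ge0 f.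
move: g0; rewrite le_eqVlt => /predU1P[g0|g0].
  rewrite -g0 mulr0.
  have [->|fg] := eqVneq (energy f g) 0; first by rewrite expr0n.
  (* With [energy g g = 0] the quadratic is affine in [l], and this [l] gives it the value -1. *)
  have := quad ((energy f f + 1) / (2 * energy f g)).
  have -> : 2 * ((energy f f + 1) / (2 * energy f g)) * energy f g = energy f f + 1.
    by field.
  by rewrite -g0 mulr0; lra.
(* The minimizer of the quadratic in [l]. *)
have := quad (energy f g / energy g g).
have -> : energy f f - 2 * (energy f g / energy g g) * energy f g +
  (energy f g / energy g g) ^+ 2 * energy g g =
  (energy f f * energy g g - energy f g ^+ 2) / energy g g by field; rewrite gt_eqF.
by rewrite pmulr_lge0 ?invr_gt0 // subr_ge0.
Qed.

(** Such a [g] has zero energy by [energyE], hence is constant along edges, and connectedness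
    spreads the value 0 from [v]. *)
Lemma lap_free (v : V) (g : V -> R) :
  g v = 0 -> (forall x, x != v -> lap g x = 0) -> forall x, g x = 0.
Proof.
move=> gv lg.
have E0 : energy g g = 0.
  rewrite energyE big1 ?mulr0 // => x _.
  by have [->|/lg->] := eqVneq x v; rewrite ?gv ?mul0r ?mulr0.
have edge x y : e x y -> g x = g y.
  move=> exy; apply/eqP; rewrite -subr_eq0 -sqrf_eq0 expr2.
  have inner0 z : 0 <= \sum_(y | e z y) (g z - g y) * (g z - g y).
    by rewrite sumr_ge0 // => u _; rewrite -expr2 sqr_ge0.
  move/eqP: E0; rewrite psumr_eq0 // => /allP /(_ x (mem_index_enum x)) /=.
  rewrite psumr_eq0 => [|u _]; last by rewrite -expr2 sqr_ge0.
  by move=> /allP /(_ y (mem_index_enum y)); rewrite exy.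
move=> x; have /connectP[p ep ->] := e_conn v x.
elim: p v gv ep {lg x} => [//|z p IH] v gv /= /andP[evz ep].
by apply: IH => //; rewrite -(edge _ _ evz).
Qed.

Section Poisson.
Variable v : V.

(** The Laplacian is singular on constants; replacing its value at [v] by [g v] makes it
    injective. *)
Definition grounded_lap (g : {ffun V -> R^o}) : {ffun V -> R^o} :=
  [ffun x => if x == v then g v else lap g x].

Fact grounded_lap_is_linear : linear grounded_lap.
Proof.
move=> k g h; apply/ffunP => x; rewrite !ffunE; case: eqP => // _.
rewrite [RHS](_ : _ = k * lap g x + lap h x) //.
rewrite /lap mulr_sumr -big_split; apply: eq_bigr => y _ /=.
by rewrite !ffunE /GRing.scale /=; ring.
Qed.

HB.instance Definition _ :=
  GRing.isLinear.Build R {ffun V -> R^o} {ffun V -> R^o} _ grounded_lap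
    grounded_lap_is_linear.

(** [lap_free] gives a trivial kernel, and an injective endomorphism in finite dimension is onto.
    Taking [b] to be the degree yields the hitting time equations. *)
Lemma poisson (b : V -> R) :
  exists g : V -> R, g v = 0 /\ forall x, x != v -> lap g x = b x.
Proof.
have ker0 : lker (linfun grounded_lap) == 0%VS.
  apply/eqP/vspaceP => g; rewrite memv_ker memv0 lfunE.
  apply/eqP/eqP => [g0|->]; last by rewrite linear0.
  have gE x : grounded_lap g x = 0 by rewrite g0 ffunE.
  apply/ffunP => x; rewrite [RHS]ffunE; apply: (@lap_free v).
    by have := gE v; rewrite ffunE eqxx.
  by move=> y yv; have := gE y; rewrite ffunE (negbTE yv).
pose b' : {ffun V -> R^o} := [ffun x => if x == v then 0 else b x].
exists ((linfun grounded_lap)^-1%VF b').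
have := lker0_lfunVK ker0 b'; rewrite lfunE => /ffunP bE.
split; first by have := bE v; rewrite !ffunE eqxx.
by move=> x xv; have := bE x; rewrite !ffunE (negbTE xv).
Qed.

End Poisson.

(* [hs] and [hv] are the expected hitting times of [s] and [v]; up to [2 * m],
   the difference [hv - hs] is the potential of a unit current from [s] to [v],
   against which [f] is tested. *)
Lemma commute_ge (s v : V) (hs hv f : V -> R) (m := \sum_x (deg e x)%:R) :
  0 < m ->
  hs s = 0 -> hv v = 0 ->
  (forall x, x != s -> lap hs x = (deg e x)%:R) ->
  (forall x, x != v -> lap hv x = (deg e x)%:R) ->
  2 * m * (f s - f v) ^+ 2 <= energy f f * (hv s + hs v).
Proof.
move=> m0 hss hvv lhs lhv.
pose g x := hv x - hs x.
have lapB x : lap g x = lap hv x - lap hs x.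
  by rewrite /lap -sumrB; apply: eq_bigr => y _; rewrite /g; ring.
(* The values of [lap h] sum to 0, which fixes the one value that the equations leave open. *)
have lapv (w : V) (h : V -> R) : (forall x, x != w -> lap h x = (deg e x)%:R) ->
    lap h w = (deg e w)%:R - m.
  move=> lh; have := sum_lap h; rewrite (bigD1 w) //= (eq_bigr _ lh).
  by rewrite /m [\sum_x (deg e x)%:R](bigD1 w) //= => ?; lra.
have lapE (w : V) (h : V -> R) x : (forall y, y != w -> lap h y = (deg e y)%:R) ->
    lap h x = (deg e x)%:R - m * (x == w)%:R.
  by move=> lh; have [->|/lh->] := eqVneq x w; rewrite ?(lapv _ _ lh) /= ?mulr1 ?mulr0 ?subr0.
have lapg x : lap g x = m * ((x == s)%:R - (x == v)%:R).
  by rewrite lapB (lapE s hs x lhs) (lapE v hv x lhv); ring.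
have pair (k : V -> R) : energy k g = 2 * m * (k s - k v).
  rewrite energyE; under eq_bigr do rewrite lapg mulrBr mulrBr.
  rewrite sumrB (bigD1 s) //= eqxx big1 => [|x /negbTE->]; last by rewrite !mulr0.
  rewrite (bigD1 v) //= eqxx big1 => [|x /negbTE->]; last by rewrite !mulr0.
  by rewrite /=; ring.
have := energy_cauchy_schwarz f g; rewrite !pair /g hss hvv subr0 sub0r opprK.
rewrite !exprMn => h.
rewrite -(@ler_pM2l _ (2 * m)) ?mulr_gt0 //; apply: le_trans (le_trans h _).
  by rewrite le_eqVlt; apply/orP; left; apply/eqP; ring.
by rewrite le_eqVlt; apply/orP; left; apply/eqP; ring.
Qed.

End Laplacian.

(** * Hitting times as lower bounds on the cover time *)

Section Walk.
Variables (R : realType) (V : finType) (e : rel V).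
Hypothesis deg_gt0 : forall v, (0 < deg e v)%N.

Lemma step_ge0 v u : 0 <= step R e v u.
Proof. by rewrite /step; case: ifP. Qed.

Lemma sum_step v (g : V -> R) :
  \sum_u step R e v u * g u = (deg e v)%:R^-1 * \sum_(u | e v u) g u.
Proof.
rewrite mulr_sumr [RHS]big_mkcond; apply: eq_bigr => u _.
by rewrite /step; case: ifP; rewrite ?mul0r.
Qed.

Lemma sum_step1 v : \sum_u step R e v u = 1.
Proof.
under eq_bigr do rewrite -[step _ _ _ _]mulr1.
by rewrite sum_step sumr_const -cardsE mulVf // pnatr_eq0 -lt0n deg_gt0.
Qed.

Lemma walk_prob_ge0 s w : 0 <= walk_prob R e s w.
Proof. by elim: w s => [|u w IH] s //=; rewrite mulr_ge0 ?step_ge0. Qed.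

Lemma walk_prob_rcons s w : \sum_u walk_prob R e s (rcons w u) = walk_prob R e s w.
Proof.
elim: w s => [|x w IH] s /=; last by rewrite -mulr_sumr IH.
by under eq_bigr do rewrite mulr1; rewrite sum_step1.
Qed.

Definition covers (s : V) (w : seq V) : bool := [forall v, v \in s :: w].

Lemma covers_rcons s w u : covers s w -> covers s (rcons w u).
Proof.
move/forallP => cw; apply/forallP => v; have := cw v.
by rewrite !inE mem_rcons inE => /orP[->//|->]; rewrite !orbT.
Qed.

Lemma COV_from_ge s N :
  ((\sum_(0 <= t < N) survival (walk_prob R e s) (covers s) t)%:E
     <= COV_from R e s)%E.
Proof.
apply: stop_time_ge.
- exact: walk_prob_ge0.
- by [].
- exact: walk_prob_rcons.
- exact: covers_rcons.
Qed.

(** After [t < #|V|.-1] steps at most [t + 1] vertices have been visited, so the survival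
    probability is still 1. *)
Lemma COV_from_ge_card s : ((#|V|.-1)%:R%:E <= COV_from R e s)%E.
Proof.
apply: le_trans (COV_from_ge s #|V|.-1); rewrite lee_fin.
rewrite -[X in X%:R <= _]subn0 -sumr_const_nat le_eqVlt; apply/orP; left.
apply/eqP/eq_big_nat => t /andP[_ tV].
rewrite -(sum_weight (W := walk_prob R e s) _ (walk_prob_rcons s) t) //.
apply: eq_bigl => w; apply/esym/negP => /forallP cw.
have : (#|V| <= size (s :: w))%N.
  rewrite (leq_trans _ (card_size _)) //; apply: subset_leq_card.
  by apply/fintype.subsetP => v _; apply: cw.
by rewrite /= size_tuple leqNgt -ltn_predRL tV.
Qed.

(** Survival function of the hitting time of [v], written as a first-step recursion to match the
    Poisson equation; [avoidE] gives its meaning on walks. *)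
Fixpoint avoid (v : V) (t : nat) (x : V) : R :=
  if x == v then 0 else
  if t is t'.+1 then \sum_u step R e x u * avoid v t' u else 1.

Lemma sum_cons_tuple (G : seq V -> R) t :
  \sum_(w : t.+1.-tuple V) G w = \sum_u \sum_(w : t.-tuple V) G (u :: w).
Proof.
rewrite pair_big /=.
rewrite (reindex (fun uw : V * t.-tuple V => [tuple of uw.1 :: uw.2])) //=.
exists (fun w : t.+1.-tuple V => (thead w, [tuple of behead w])) => [[u w] _|w _].
  by congr pair; apply: val_inj.
by rewrite -tuple_eta.
Qed.

Lemma avoidE v t x :
  avoid v t x = \sum_(w : t.-tuple V | v \notin x :: w) walk_prob R e x w.
Proof.
elim: t x => [|t IH] x /=.
  case: eqVneq => [->|xv]; first by rewrite big1 // => w; rewrite inE eqxx.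
  rewrite (big_pred1 [tuple]) // => w.
  by rewrite tuple0 /= eqxx !inE eq_sym xv.
case: eqVneq => [->|xv]; first by rewrite big1 // => w; rewrite inE eqxx.
rewrite [RHS]big_mkcond /=.
rewrite (sum_cons_tuple (fun w => if v \notin x :: w then walk_prob R e x w else 0)).
apply: eq_bigr => u _; rewrite IH mulr_sumr [LHS]big_mkcond; apply: eq_bigr => w _ /=.
by rewrite !inE [v == x]eq_sym (negbTE xv).
Qed.

Lemma avoid_le_survival v t s :
  avoid v t s <= survival (walk_prob R e s) (covers s) t.
Proof.
rewrite avoidE /survival [leLHS]big_mkcond [leRHS]big_mkcond; apply: ler_sum => w _.
case: ifP => [vw|_]; last by case: ifP => // _; apply: walk_prob_ge0.
by case: ifP => // /negbFE /forallP /(_ v) vw'; rewrite vw' in vw.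
Qed.

Lemma avoid_dec v t x : avoid v t.+1 x <= avoid v t x.
Proof.
elim: t x => [|t IH] x /=; case: ifP => // _.
  rewrite -[leRHS](sum_step1 x); apply: ler_sum => u _.
  by rewrite ler_piMr ?step_ge0 //; case: ifP.
by apply: ler_sum => u _; rewrite ler_wpM2l ?step_ge0 //; apply: IH.
Qed.

(** The Poisson equation says that [h] is 1 plus its average after one step. It is unrolled [N]
    times, and [h] is bounded by [M] on the walks that have not met [v]. *)
Lemma hitting_le (v : V) (h : V -> R) (M : R) :
  h v = 0 -> (forall x, x != v -> lap e h x = (deg e x)%:R) ->
  (forall x, h x <= M) ->
  forall N x, h x <= \sum_(0 <= t < N) avoid v t x + M * avoid v N x.
Proof.
move=> hv lh hM; have M0 : 0 <= M by rewrite -hv.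
have hE x : x != v -> h x = 1 + \sum_u step R e x u * h u.
  move=> xv; have d0 : (deg e x)%:R != 0 :> R by rewrite pnatr_eq0 -lt0n deg_gt0.
  rewrite sum_step; apply: (mulfI d0); rewrite mulrDr mulr1 mulVKf // mulr_natl.
  have := lh x xv; rewrite /lap sumrB sumr_const -cardsE -/(deg e x) => <-.
  by rewrite subrK.
elim=> [|N IH] x.
  rewrite big_geq // add0r /=; case: eqVneq => [->|_]; last by rewrite mulr1.
  by rewrite hv mulr0.
rewrite big_nat_recl //=; have [->|xv] := eqVneq x v.
  by rewrite hv mulr0 addr0 add0r sumr_ge0 // => t _; case: t => [|t] /=; rewrite eqxx.
rewrite hE // -addrA lerD2l exchange_big /= mulr_sumr -big_split.
apply: ler_sum => u _ /=.
rewrite -mulr_sumr mulrCA -mulrDr.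
by rewrite ler_wpM2l ?step_ge0 ?IH.
Qed.

(** Covering includes hitting [v]. If the cover time is a finite [B], monotonicity gives
    [N * avoid v N x <= B], so the remainder in [hitting_le] tends to 0. *)
Lemma hitting_le_COV_from (v : V) (h : V -> R) :
  h v = 0 -> (forall x, x != v -> lap e h x = (deg e x)%:R) ->
  forall x, ((h x)%:E <= COV_from R e x)%E.
Proof.
move=> hv lh x.
pose M := \sum_u `|h u|.
have hM u : h u <= M.
  by rewrite /M (bigD1 u) //= (le_trans (ler_norm _)) // lerDl sumr_ge0.
have M0 : 0 <= M by rewrite -hv.
have hN := hitting_le hv lh hM.
have CN N : ((\sum_(0 <= t < N) avoid v t x)%:E <= COV_from R e x)%E.
  apply: le_trans (COV_from_ge x N); rewrite lee_fin.
  by apply: ler_sum => t _; apply: avoid_le_survival.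
case: (COV_from R e x) CN => [B| |] CN; last by have := CN 0.
  have {}CN N : \sum_(0 <= t < N) avoid v t x <= B by rewrite -lee_fin.
  rewrite lee_fin leNgt; apply/negP => Bh.
  have N_avoid N : N%:R * avoid v N x <= B.
    apply: le_trans (CN N); rewrite mulr_natl -[X in _ *+ X]subn0 -sumr_const_nat.
    apply: ler_sum_nat => i /andP[_ iN].
    elim: N iN => // N IH; rewrite ltnS leq_eqVlt => /predU1P[->|/IH];
      first exact: avoid_dec.
    exact: le_trans (avoid_dec _ _ _).
  have B0 : 0 <= B by have := CN 0; rewrite big_geq.
  (* Large enough that [k * (h x - B)] exceeds [M * B], which the remainder bound forbids. *)
  pose k := Num.bound (M * B / (h x - B)).
  have d0 : 0 < h x - B by rewrite subr_gt0.
  have kP : M * B / (h x - B) < k%:R.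
    by rewrite archi_boundP // divr_ge0 ?mulr_ge0 // ltW.
  rewrite ltr_pdivrMr // in kP.
  have h1 : h x - B <= M * avoid v k x by have := hN k x; have := CN k; lra.
  have h2 : k%:R * (h x - B) <= M * B.
    apply: le_trans (ler_wpM2l (ler0n _ k) h1) _.
    by rewrite mulrCA ler_wpM2l.
  by move: (lt_le_trans kP h2); rewrite ltxx.
by rewrite leey.
Qed.

End Walk.

(** * Broadcast time compared with the slowed activation schedule *)

Section Broadcast.
Variables (R : realType) (V : finType) (e : rel V).
Hypotheses (e_sym : symmetric e) (e_conn : forall x y, connect e x y).
Hypothesis deg_gt0 : forall v, (0 < deg e v)%N.

Notation rounds := (seq {ffun V -> V}).

Definition choice_prob (f : {ffun V -> V}) : R := \prod_v step R e v (f v).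

Lemma choice_prob_ge0 f : 0 <= choice_prob f.
Proof. by apply: prodr_ge0 => v _; apply: step_ge0. Qed.

Lemma sum_choice_prob (g : V -> V -> R) :
  \sum_(f : {ffun V -> V}) \prod_v (step R e v (f v) * g v (f v)) =
  \prod_v \sum_u step R e v u * g v u.
Proof. by rewrite bigA_distr_bigA. Qed.

Lemma sum_choice_prob1 : \sum_f choice_prob f = 1.
Proof.
under eq_bigr do (rewrite /choice_prob; under eq_bigr do rewrite -[step _ _ _ _]mulr1).
rewrite (sum_choice_prob (fun _ _ => 1)) big1 // => v _.
by under eq_bigr do rewrite mulr1; apply: sum_step1.
Qed.

Lemma choices_prob_ge0 (fs : rounds) : 0 <= choices_prob R e fs.
Proof. by apply: prodr_ge0 => f _; apply: choice_prob_ge0. Qed.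

Lemma choices_prob_rcons (fs : rounds) :
  \sum_f choices_prob R e (rcons fs f) = choices_prob R e fs.
Proof.
rewrite -[RHS]mulr1 -sum_choice_prob1 mulr_sumr; apply: eq_bigr => f _.
by rewrite /choices_prob -cats1 big_cat big_seq1.
Qed.

(** Independence across rounds; [sum_choice_prob] is its counterpart across vertices. *)
Lemma sum_choices_prob (g : nat -> {ffun V -> V} -> R) t :
  \sum_(fs : t.-tuple {ffun V -> V})
     choices_prob R e fs * \prod_(i < t) g i (nth [ffun x => x] fs i) =
  \prod_(i < t) \sum_f choice_prob f * g i f.
Proof.
elim: t => [|t IH].
  rewrite big_ord0 (big_pred1 [tuple]) => [|w]; last first.
    by apply/esym/eqP/val_inj; rewrite tuple0.
  by rewrite big_ord0 mulr1 /choices_prob big_nil.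
rewrite (sum_rcons_tuple (fun fs => choices_prob R e fs *
  \prod_(i < t.+1) g i (nth [ffun x => x] fs i))) big_ord_recr /= -IH mulr_suml.
apply: eq_bigr => fs _; rewrite mulr_sumr; apply: eq_bigr => f _.
rewrite big_ord_recr /= nth_rcons size_tuple ltnn eqxx.
rewrite (eq_bigr (fun i : 'I_t => g i (nth [ffun x => x] fs i))) => [|i _];
  last by rewrite nth_rcons size_tuple ltn_ord.
rewrite /choices_prob -cats1 big_cat big_seq1 /= -/(choice_prob f).
by rewrite mulrACA.
Qed.

Definition all_informed (s : V) (fs : rounds) : bool :=
  foldl (@push V) [set s] fs == [set: V].

Lemma all_informed_rcons s fs f : all_informed s fs -> all_informed s (rcons fs f).
Proof.
by rewrite /all_informed -cats1 foldl_cat /= => /eqP->; rewrite /push finset.setTU.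
Qed.

Lemma RBA_from_le s (B : R) :
  (forall N, \sum_(0 <= t < N) survival (choices_prob R e) (all_informed s) t <= B) ->
  (RBA_from R e s <= B%:E)%E.
Proof.
apply: stop_time_le.
- exact: choices_prob_ge0.
- by rewrite /choices_prob big_nil.
- exact: choices_prob_rcons.
- exact: all_informed_rcons.
Qed.

(** At time 0 only [s] is informed, so survival at 0 has probability 1. This keeps the denominator
    of the ratio positive. *)
Lemma RBA_from_ge1 s : (1 < #|V|)%N -> (1 <= RBA_from R e s)%E.
Proof.
move=> V1.
have := @stop_time_ge R _ (choices_prob R e) (all_informed s) _ _ _ _ 1.
rewrite big_nat1 => h; apply: le_trans (h _ _ _ _).
- rewrite lee_fin -(sum_weight (W := choices_prob R e) _ choices_prob_rcons 0);
    last by rewrite /choices_prob big_nil.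
  rewrite le_eqVlt /survival; apply/orP; left; apply/eqP/eq_bigl => w.
  apply/esym/eqP => sV; have := congr1 (fun A : {set V} => #|A|) sV.
  by rewrite tuple0 /= cards1 cardsT => VE; rewrite -VE in V1.
- exact: choices_prob_ge0.
- by rewrite /choices_prob big_nil.
- exact: choices_prob_rcons.
- exact: all_informed_rcons.
Qed.

Lemma informed_mono s (fs : rounds) i j :
  (i <= j)%N -> informed s fs i \subset informed s fs j.
Proof.
move=> ij; rewrite /informed -(subnKC ij) takeD foldl_cat.
move: (foldl _ _ (take i fs)) (take (j - i) _) => I gs.
elim: gs I => [|g gs IH] I //=.
by apply: fintype.subset_trans (IH _); rewrite /push finset.subsetUl.
Qed.

Lemma informedS s (fs : rounds) i : (i < size fs)%N ->
  informed s fs i.+1 = push (informed s fs i) (nth [ffun x => x] fs i).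
Proof.
by move=> i_lt; rewrite /informed (take_nth [ffun x => x]) // -cats1 foldl_cat.
Qed.

Section Schedule.
Variables (s : V) (D L : nat).
Hypotheses (D_gt0 : (0 < D)%N) (deg_le : forall v, (deg e v <= D)%N).
Let f := activation s D e_sym e_conn.

(* Round [i] is one in which [x] should push to [y] if the broadcast keeps to
   the activation schedule slowed down by the factor [L]. *)
Definition due (y : V) (i : nat) (x : V) : bool :=
  e y x && (L * f x <= i < L * f y)%N.

Definition missed (y : V) (t : nat) (fs : rounds) : bool :=
  [forall i : 'I_t, forall x, due y i x ==> (nth [ffun x => x] fs i x != y)].

(** Contrapositive, by induction on activation times: if [y] is chosen by some [x] in a due round,
    then [f x < f y], so [x] was informed by round [L * f x] and [y] is informed by round
    [L * f y]. *)
Lemma missed_of_late (t : nat) (fs : rounds) :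
  size fs = t -> (forall y, L * f y <= t)%N -> ~~ all_informed s fs ->
  [exists y, (y != s) && missed y t fs].
Proof.
move=> sz ft; apply: contraR; rewrite negb_exists => /forallP nomiss.
have on_time n y : (f y <= n)%N -> y \in informed s fs (L * f y).
  elim: n y => [|n IH] y fy.
    move: fy; rewrite leqn0 activation_eq0 // => /eqP->.
    rewrite /f activation_source muln0 /informed take0 /=; exact: set11.
  have [->|ys] := eqVneq y s.
    by rewrite /f activation_source muln0 /informed take0 /=; exact: set11.
  have := nomiss y; rewrite ys /= => /forallPn[i] /forallPn[x].
  rewrite negb_imply negbK => /andP[/andP[eyx /andP[fi iy]] /eqP chosen].
  have xy : (f x < f y)%N.
    rewrite ltnNge; apply/negP => yx.
    by have := leq_ltn_trans fi iy; rewrite ltnNge leq_mul2l yx orbT.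
  have xI : x \in informed s fs i.
    apply: (fintype.subsetP (informed_mono s fs fi)); apply: IH.
    by rewrite -ltnS (leq_trans xy).
  apply: (fintype.subsetP (informed_mono s fs iy)).
  rewrite informedS ?sz ?ltn_ord // /push inE; apply/orP; right.
  by apply/imsetP; exists x.
rewrite /all_informed finset.eqEsubset finset.subsetT /=; apply/fintype.subsetP => y _.
have := fintype.subsetP (informed_mono s fs (ft y)) _ (on_time _ y (leqnn _)).
by rewrite /informed -sz take_size.
Qed.

Lemma sum_due (y : V) (t : nat) : (L * f y <= t)%N ->
  (\sum_(i < t) \sum_x due y i x = \sum_(x | e y x) L * (f y - f x))%N.
Proof.
move=> ft; rewrite exchange_big [RHS]big_mkcond; apply: eq_bigr => x _ /=.
rewrite /due; case: (e y x) => /=; last by rewrite big1.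
rewrite -(big_mkord xpredT (fun i => nat_of_bool (L * f x <= i < L * f y)%N)).
have out a b : (forall i, (a <= i < b)%N -> (L * f x <= i < L * f y)%N = false) ->
    (\sum_(a <= i < b) (L * f x <= i < L * f y) = 0)%N.
  by move=> h; rewrite big_nat_cond big1 // => i /andP[/h->].
rewrite (@big_cat_nat _ _ _ (L * f y)) //= (out (L * f y)%N t) => [|i]; last first.
  by move=> /andP[h _]; rewrite [(i < _)%N]ltnNge h andbF.
rewrite addn0 mulnBr; have [yx|xy] := leqP (L * f y) (L * f x).
  rewrite out; first by apply/esym/eqP.
  by move=> i /andP[_ h]; rewrite leqNgt (leq_trans h yx).
rewrite (@big_cat_nat _ _ _ (L * f x)) ?(ltnW xy) //= out => [|i]; last first.
  by move=> /andP[_ h]; rewrite leqNgt h.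
rewrite add0n -[RHS]muln1 -sum_nat_const_nat; apply: eq_big_nat => i h.
by rewrite h.
Qed.

(** Bernoulli gives [(1 + 1/D)^D >= 2], and [(1 - 1/D) (1 + 1/D) <= 1]. The base is 0 when [D = 1],
    a case treated apart. *)
Lemma half_pow : (1 - D%:R^-1) ^+ D <= 2^-1 :> R.
Proof.
have D0 : 0 < D%:R :> R by rewrite ltr0n.
have [q0|q0] := eqVneq (1 - D%:R^-1 : R) 0.
  by rewrite q0 expr0n gtn_eqF //= invr_ge0.
have q1 : 0 < 1 - D%:R^-1 :> R.
  by rewrite lt_def q0 subr_ge0 invf_le1 // ler1n.
have bern n : 1 + n%:R / D%:R <= (1 + D%:R^-1) ^+ n :> R.
  elim: n => [|n IH]; first by rewrite mul0r addr0 expr0.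
  rewrite exprSr; apply: le_trans (ler_wpM2r _ IH); last by rewrite addr_ge0 // invr_ge0 ltW.
  rewrite -natr1 mulrDl mul1r.
  have : 0 <= n%:R / D%:R * D%:R^-1 :> R by rewrite !mulr_ge0 // invr_ge0 ltW.
  by lra.
have : (1 - D%:R^-1) ^+ D * (1 + D%:R^-1) ^+ D <= 1 :> R.
  rewrite -exprMn exprn_ile1 // ?mulr_ge0 ?(ltW q1) // ?addr_ge0 ?invr_ge0 ?(ltW D0) //.
  have : 0 <= D%:R^-1 * D%:R^-1 :> R by rewrite mulr_ge0 // invr_ge0 ltW.
  by lra.
have := bern D; rewrite divff ?gt_eqF // => h2 h1.
rewrite -(@ler_pM2r _ 2) // mulVf //; apply: le_trans h1.
by rewrite ler_pM2l ?exprn_gt0 //; lra.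
Qed.

(** The indicator of [missed] is a product over rounds and vertices, so its expectation factorizes.
    Each due pair contributes at most [1 - 1/D], and [activation_ge] provides at least [D * L] of
    them. *)
Lemma missed_prob (y : V) (t : nat) : y != s -> (L * f y <= t)%N ->
  \sum_(fs : t.-tuple {ffun V -> V} | missed y t fs) choices_prob R e fs
    <= 2^-1 ^+ L.
Proof.
move=> ys ft.
pose g i x u : R := (due y i x ==> (u != y))%:R.
have mE (fs : t.-tuple {ffun V -> V}) :
    (missed y t fs)%:R = \prod_(i < t) \prod_x g i x (nth [ffun x => x] fs i x) :> R.
  case: (boolP (missed y t fs)) => [/forallP m|/forallPn[i /forallPn[x nx]]].
    rewrite big1 // => i _; rewrite big1 // => x _.
    by have /forallP/(_ x) := m i; rewrite /g => ->.
  by rewrite (bigD1 i) //= (bigD1 x) //= /g (negbTE nx) !mul0r.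
have -> : \sum_(fs : t.-tuple {ffun V -> V} | missed y t fs) choices_prob R e fs =
  \sum_(fs : t.-tuple {ffun V -> V}) choices_prob R e fs *
     \prod_(i < t) \prod_x g i x (nth [ffun x => x] fs i x).
  rewrite big_mkcond; apply: eq_bigr => fs _; rewrite -mE.
  by case: ifP; rewrite ?mulr1 ?mulr0.
rewrite (sum_choices_prob (fun i f => \prod_x g i x (f x))).
have D0 : 0 < D%:R :> R by rewrite ltr0n.
have q0 : 0 <= 1 - D%:R^-1 :> R by rewrite subr_ge0 invf_le1 // ler1n.
have factor i : \sum_f0 choice_prob f0 * \prod_x g i x (f0 x)
    <= (1 - D%:R^-1) ^+ (\sum_x due y i x)%N.
  rewrite (eq_bigr (fun h : {ffun V -> V} => \prod_x (step R e x (h x) * g i x (h x))))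
    => [|h _]; last by rewrite big_split.
  rewrite (sum_choice_prob (g i)) -prodrXr.
  apply: ler_prod => x _; apply/andP; split.
    by apply: sumr_ge0 => u _; rewrite mulr_ge0 ?step_ge0 // /g ler0n.
  rewrite /g; case: (boolP (due y i x)) => [/andP[eyx _]|_] /=; last first.
    by under eq_bigr do rewrite mulr1; rewrite sum_step1 // expr0.
  have <- : \sum_u step R e x u - step R e x y = \sum_u step R e x u * (u != y)%:R.
    rewrite (bigD1 y) //= addrAC subrr add0r [RHS](bigD1 y) //= eqxx mulr0 add0r.
    by apply: eq_bigr => u ->; rewrite mulr1.
  rewrite sum_step1 // expr1 lerD2l lerN2 /step e_sym eyx.
  by rewrite lef_pV2 ?posrE ?ltr0n ?deg_gt0 // ler_nat.
apply: (@le_trans _ _ (\prod_(i < t) (1 - D%:R^-1) ^+ (\sum_x due y i x)%N)).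
  apply: ler_prod => i _; rewrite factor andbT; apply: sumr_ge0 => h _.
  by rewrite mulr_ge0 ?choice_prob_ge0 // prodr_ge0 // => x _; rewrite /g ler0n.
rewrite prodrXr sum_due // -big_distrr /=.
apply: (@le_trans _ _ ((1 - D%:R^-1) ^+ (D * L)%N)).
  apply: ler_wiXn2l => //.
  by rewrite mulnC leq_mul2l activation_ge // orbT.
by rewrite exprM lerXn2r ?nnegrE ?exprn_ge0 ?invr_ge0 // half_pow.
Qed.

Lemma survival_schedule (F : nat) : (forall y, f y <= F)%N ->
  survival (choices_prob R e) (all_informed s) (L * F) <= #|V|%:R * 2^-1 ^+ L.
Proof.
move=> fF; have ft y : (L * f y <= L * F)%N by rewrite leq_mul2l fF orbT.
apply: (@le_trans _ _ (\sum_(y | y != s)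
    \sum_(fs : (L * F).-tuple {ffun V -> V} | missed y (L * F) fs) choices_prob R e fs)).
  under [leRHS]eq_bigr do rewrite big_mkcond.
  rewrite exchange_big /survival big_mkcond /=; apply: ler_sum => fs _.
  have ge0 y : 0 <= (if missed y (L * F) fs then choices_prob R e fs else 0).
    by case: ifP => // _; apply: choices_prob_ge0.
  case: ifP => [late|_]; last by rewrite sumr_ge0.
  have /existsP[y /andP[ys my]] := missed_of_late (size_tuple fs) ft late.
  by rewrite (bigD1 y) //= my lerDl sumr_ge0.
apply: (@le_trans _ _ (\sum_(y | y != s) 2^-1 ^+ L)).
  by apply: ler_sum => y ys; apply: missed_prob.
rewrite sumr_const -[leLHS]mulr_natl ler_wpM2r ?exprn_ge0 ?invr_ge0 //.
by rewrite ler_nat max_card.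
Qed.

End Schedule.

(** The survival function is summed in blocks of length [F]: the first [K.+1] blocks count at most
    [F] each, the later ones decay geometrically and add at most [2 * F]. *)
Lemma RBA_from_le_activation (s : V) (D F : nat) (D_gt0 : (0 < D)%N) :
  (0 < F)%N -> (forall v, deg e v <= D)%N ->
  (forall y, activation s D e_sym e_conn y <= F)%N ->
  (RBA_from R e s <= (F * (trunc_log 2 #|V| + 3))%:R%:E)%E.
Proof.
move=> F0 degD fF; apply: RBA_from_le => N.
set a := survival _ _.
have a0 t : 0 <= a t by apply: survival_ge0; apply: choices_prob_ge0.
have a_anti i j : (i <= j)%N -> a j <= a i.
  elim: j => [|j IH]; first by rewrite leqn0 => /eqP->.
  rewrite leq_eqVlt => /predU1P[->//|]; rewrite ltnS => /IH; apply: le_trans.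
  apply: survival_dec; [exact: choices_prob_ge0|exact: choices_prob_rcons|].
  exact: all_informed_rcons.
have a1 t : a t <= 1.
  apply: survival_le1; [exact: choices_prob_ge0| |exact: choices_prob_rcons].
  by rewrite /choices_prob big_nil.
have aL L : a (L * F)%N <= #|V|%:R * 2^-1 ^+ L.
  exact: survival_schedule fF.
have blocks m : \sum_(0 <= t < m * F) a t <= F%:R * \sum_(0 <= j < m) a (j * F)%N.
  elim: m => [|m IH]; first by rewrite !big_geq // mulr0.
  rewrite (@big_cat_nat _ _ _ (m * F)) ?leq_mul //= [in leRHS]big_nat_recr //=.
  rewrite mulrDr lerD // (@le_trans _ _ (\sum_(m * F <= t < m.+1 * F) a (m * F)%N)) //.
    by apply: ler_sum_nat => t /andP[h _]; apply: a_anti.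
  by rewrite sumr_const_nat mulSn addnK mulr_natl.
set K := trunc_log 2 #|V|.
(* The union bound factor [#|V|] is absorbed by [2 ^ K.+1]. *)
have tail i : a ((K.+1 + i) * F)%N <= 2^-1 ^+ i.
  apply: le_trans (aL _) _; rewrite exprD mulrA ler_piMl ?exprn_ge0 ?invr_ge0 //.
  rewrite exprVn ler_pdivrMr ?exprn_gt0 // mul1r -natrX ler_nat ltnW //.
  exact: trunc_log_ltn.
have geo M : \sum_(0 <= i < M) 2^-1 ^+ i <= 2 - 2^-1 ^+ M * 2 :> R.
  elim: M => [|M IH]; first by rewrite big_geq // expr0; lra.
  by rewrite big_nat_recr //= exprS; lra.
apply: (@le_trans _ _ (\sum_(0 <= t < (K.+1 + N) * F) a t)).
  have NF : (N <= (K.+1 + N) * F)%N by nia.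
  by rewrite (@big_cat_nat _ _ _ N 0%N ((K.+1 + N) * F)%N) //= lerDl sumr_ge0.
apply: le_trans (blocks _) _; rewrite natrM ler_wpM2l //.
rewrite (@big_cat_nat _ _ _ K.+1) ?leq_addr //=.
have h1 : \sum_(0 <= j < K.+1) a (j * F)%N <= K.+1%:R.
  rewrite -[X in _ <= X%:R]subn0 -sumr_const_nat.
  by apply: ler_sum_nat => j _; apply: a1.
have h2 : \sum_(K.+1 <= j < K.+1 + N) a (j * F)%N <= 2.
  rewrite -{1}[K.+1]add0n big_addn addKn.
  apply: (@le_trans _ _ (\sum_(0 <= i < N) 2^-1 ^+ i)).
    by apply: ler_sum_nat => i _; rewrite addnC.
  by apply: le_trans (geo N) _; rewrite gerBl mulr_ge0 // exprn_ge0 // invr_ge0.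
rewrite [(K + 3)%N]addnS -addSn natrD; lra.
Qed.

End Broadcast.

(** * Degrees in a connected graph *)

Lemma exists_other (V : finType) (v : V) : (1 < #|V|)%N -> exists u, u != v.
Proof.
move=> V1; have : (0 < #|[set~ v]|)%N by rewrite cardsC1 -subn1 subn_gt0.
by case/card_gt0P => u; rewrite !inE => uv; exists u.
Qed.

Lemma deg_gt0_connected (V : finType) (e : rel V) :
  (forall x y, connect e x y) -> (1 < #|V|)%N -> forall v, (0 < deg e v)%N.
Proof.
move=> e_conn V1 v; have [u uv] := exists_other v V1.
have /connectP[[|w p]] := e_conn v u; first by move=> _ /= uE; rewrite uE eqxx in uv.
by case/andP => evw _ _; apply/card_gt0P; exists w; rewrite inE.
Qed.

Lemma mindeg_le (V : finType) (e : rel V) (v : V) : (mindeg e <= deg e v)%N.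
Proof.
rewrite /mindeg; have := mem_index_enum v.
elim: (index_enum V) => // x r IH; rewrite big_cons inE => /predU1P[<-|/IH].
  exact: geq_minl.
by apply: leq_trans; apply: geq_minr.
Qed.

Lemma mindeg_gt0 (V : finType) (e : rel V) :
  (forall x y, connect e x y) -> (1 < #|V|)%N -> (0 < mindeg e)%N.
Proof.
move=> e_conn V1; rewrite /mindeg; elim/big_ind: _ => [|x y x0 y0|v _].
- exact: ltnW.
- by rewrite leq_min x0.
- exact: deg_gt0_connected.
Qed.

(** * Both bounds in terms of the last activation time, and their quotient *)

(** [F] is the largest activation time from [s]; sharing it between the two bounds lets it cancel in
    the ratio. *)
Lemma cover_broadcast_bound (R : realType) (c : R) (V : finType) (e : rel V) (s : V) :
  1 <= c -> simple_connected e -> (1 < #|V|)%N ->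
  (maxdeg e)%:R <= c * (mindeg e)%:R ->
  exists2 F : nat,
    (RBA_from R e s <= (F * (trunc_log 2 #|V| + 3))%:R%:E)%E &
    ((F%:R * (Num.sqrt #|V|%:R / Num.sqrt (mindeg e)%:R) / (4 * c))%:E <= COV R e)%E.
Proof.
move=> c1 [e_sym e_irr e_conn] V1 Dc.
have deg_gt0 := deg_gt0_connected e_conn V1.
set n := #|V| in V1 *; set D := maxdeg e; set d := mindeg e.
have degD v : (deg e v <= D)%N by apply: (leq_bigmax v).
have D_gt0 : (0 < D)%N := leq_trans (deg_gt0 s) (degD s).
have d_gt0 : (0 < d)%N := mindeg_gt0 e_conn V1.
pose f := activation s D e_sym e_conn.
pose v := [arg max_(y > s) f y].
have fF y : (f y <= f v)%N by rewrite /v; case: arg_maxnP => // i _ imax; apply: imax.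
have F_gt0 : (0 < f v)%N.
  have [u us] := exists_other s V1.
  apply: leq_trans (fF u).
  by rewrite lt0n /f (activation_eq0 _ _ _ D_gt0).
exists (f v); first exact: (RBA_from_le_activation R deg_gt0 D_gt0 F_gt0 degD fF).
have [hs [hss lhs]] := @poisson R V e e_sym e_conn s (fun x => (deg e x)%:R).
have [hv [hvv lhv]] := @poisson R V e e_sym e_conn v (fun x => (deg e x)%:R).
pose fR x : R := (f x)%:R.
pose m : R := \sum_x (deg e x)%:R.
have m_ge : n%:R * d%:R <= m.
  rewrite mulr_natl -sumr_const; apply: ler_sum => x _; by rewrite ler_nat; apply: mindeg_le.
have dR : 0 < d%:R :> R by rewrite ltr0n.
have nR : 0 < n%:R :> R by rewrite ltr0n ltnW.
have DR : 1 <= D%:R :> R by rewrite ler1n.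
have m0 : 0 < m by apply: lt_le_trans m_ge; rewrite mulr_gt0.
have commute := commute_ge e_sym fR m0 hss hvv lhs lhv.
(* Each edge is charged to its later endpoint. The 8 is 2, for ordered pairs, times 4, from
   [2 D^2 + 2 deg <= 4 D^2]. *)
have fE : energy e fR fR <= n%:R * (8 * D%:R ^+ 2).
  pose G y x : R := if (f x < f y)%N then (fR y - fR x) ^+ 2 else 0.
  have -> : energy e fR fR = 2 * \sum_y \sum_(x | e y x) G y x.
    have swap : \sum_y \sum_(x | e y x) G x y = \sum_y \sum_(x | e y x) G y x.
      under eq_bigr do rewrite big_mkcond /=.
      rewrite exchange_big; apply: eq_bigr => y _ /=.
      by rewrite -big_mkcond; apply: eq_bigl => x; rewrite e_sym.
    rewrite mulr2n mulrDl mul1r -{2}swap.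
    rewrite -big_split; apply: eq_bigr => y _; rewrite -big_split.
    apply: eq_bigr => x _ /=; rewrite /G /fR.
    by case: ltngtP => [h|h|->]; rewrite ?subrr; ring.
  have Gy y : \sum_(x | e y x) G y x <= 4 * D%:R ^+ 2.
    have sq := activation_sqr s e_sym e_conn D_gt0 y.
    apply: (@le_trans _ _ (2 * D ^ 2 + 2 * deg e y)%N%:R).
      apply: le_trans (_ : _ <= _%:R) _; last by rewrite ler_nat; exact: sq.
      rewrite natr_sum big_mkcondr; apply: ler_sum => x _; rewrite /G -/f.
      by case: ifP => // xy; rewrite natrX natrB // ltnW.
    rewrite -natrX -natrM ler_nat; have := degD y; move: D_gt0.
    by rewrite -mulnn; nia.
  have -> : n%:R * (8 * D%:R ^+ 2) = 2 * \sum_(y : V) 4 * D%:R ^+ 2 :> R.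
    by rewrite sumr_const -mulr_natl -/n; ring.
  by rewrite ler_pM2l //; apply: ler_sum.
have COV_ge x : (COV_from R e x <= COV R e)%E by apply: le_bigmax.
have hvC : ((hv s)%:E <= COV R e)%E.
  by apply: le_trans (COV_ge s); exact: (hitting_le_COV_from deg_gt0 hvv lhv s).
have hsC : ((hs v)%:E <= COV R e)%E.
  by apply: le_trans (COV_ge v); exact: (hitting_le_COV_from deg_gt0 hss lhs v).
have nC : ((n.-1)%:R%:E <= COV R e)%E.
  by apply: le_trans (COV_ge s); apply: COV_from_ge_card.
case: (COV R e) hvC hsC nC => [B| |]; rewrite ?leey // !lee_fin => hvB hsB nB.
have B_ge : n%:R <= 2 * B.
  apply: (@le_trans _ _ (2 * n.-1%:R)); last by rewrite ler_pM2l.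
  by rewrite -natrM ler_nat; lia.
have B0 : 0 <= B by rewrite (le_trans _ nB).
pose F : R := (f v)%:R; have F0 : 0 <= F by [].
have fRsv : (fR s - fR v) ^+ 2 = F ^+ 2.
  by rewrite /fR /f activation_source sub0r sqrrN.
have h1 : 2 * m * F ^+ 2 <= n%:R * (8 * D%:R ^+ 2) * (2 * B).
  rewrite -fRsv; apply: le_trans commute _.
  apply: le_trans (_ : _ <= energy e fR fR * (2 * B)) _.
    by rewrite ler_wpM2l ?energy_ge0 //; lra.
  by rewrite ler_wpM2r // mulr_ge0.
have h2 : d%:R * F ^+ 2 <= 8 * D%:R ^+ 2 * B.
  rewrite -(ler_pM2l nR) -(@ler_pM2l _ 2) //.
  apply: le_trans (_ : _ <= 2 * m * F ^+ 2) _.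
    by rewrite -[leRHS]mulrA ler_pM2l // mulrA ler_wpM2r ?sqr_ge0.
  by apply: le_trans h1 _; rewrite le_eqVlt; apply/orP; left; apply/eqP; ring.
have h3 : F ^+ 2 <= 8 * c ^+ 2 * d%:R * B.
  rewrite -(ler_pM2l dR); apply: le_trans h2 _.
  have D2 : D%:R ^+ 2 <= (c * d%:R) ^+ 2 by rewrite lerXn2r ?nnegrE // (le_trans _ Dc).
  apply: le_trans (_ : _ <= 8 * (c * d%:R) ^+ 2 * B) _.
    by rewrite ler_wpM2r // ler_pM2l.
  by rewrite le_eqVlt; apply/orP; left; apply/eqP; ring.
have c0 : 0 < c by apply: lt_le_trans c1.
have sd : 0 < Num.sqrt d%:R :> R by rewrite sqrtr_gt0.
(* Squared, this is the product of [h3] and [B_ge]: [8 c^2 d B * 2 B = (4 c)^2 d B^2]. *)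
have key : F * Num.sqrt n%:R <= 4 * c * Num.sqrt d%:R * B.
  rewrite -(@ler_pXn2r _ 2) ?nnegrE ?mulr_ge0 ?sqrtr_ge0 ?(ltW c0) //.
  rewrite !exprMn !sqr_sqrtr ?ler0n //.
  apply: le_trans (_ : _ <= (8 * c ^+ 2 * d%:R * B) * (2 * B)) _.
    by apply: ler_pM; rewrite ?sqr_ge0 // ltW.
  by rewrite le_eqVlt; apply/orP; left; apply/eqP; ring.
rewrite ler_pdivrMr ?mulr_gt0 // mulrA ler_pdivrMr //.
by apply: le_trans key _; rewrite le_eqVlt; apply/orP; left; apply/eqP; ring.
Qed.

Theorem theorem4p5 (R : realType) (c : R) (hc : 1 <= c) :
  exists C : R, 0 < C /\
    forall (V : finType) (e : rel V),
      simple_connected e ->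
      (2 <= #|V|)%N ->
      (maxdeg e)%:R <= c * (mindeg e)%:R ->
      ((C * (Num.sqrt #|V|%:R / Num.sqrt (mindeg e)%:R) * (1 / ln #|V|%:R))%:E
         <= cover_broadcast_ratio R e)%E.
Proof.
have ln2 : 0 < ln 2 :> R by rewrite ln_gt0 // ltr1n.
(* The factor [4 * c] comes from [cover_broadcast_bound], the factor [4 / ln 2] from [log_le]. *)
exists (ln 2 / (16 * c)); have c0 : 0 < c by apply: lt_le_trans hc.
split; first by rewrite divr_gt0 ?mulr_gt0.
move=> V e G V1 Dc; rewrite /cover_broadcast_ratio.
set n := #|V| in V1 *; set r := _ / Num.sqrt _.
have lnn : 0 < ln n%:R :> R by rewrite ln_gt0 // ltr1n.
have [s0 _] : exists s : V, s \in V by apply/card_gt0P; apply: ltnW.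
have bound s := cover_broadcast_bound s hc G V1 Dc.
have [_ _ e_conn] := G.
have r_gt0 : 0 < r.
  by rewrite divr_gt0 // sqrtr_gt0 ltr0n ?mindeg_gt0 // ltnW.
have RBA_ge1 : (1 <= RBA R e)%E.
  apply: le_trans (RBA_from_ge1 R (deg_gt0_connected e_conn V1) s0 V1) _.
  exact: le_bigmax.
have RBA_fin : (RBA R e < +oo)%E.
  apply: bigmax_lt => // s _; have [F RF _] := bound s.
  exact: le_lt_trans RF (ltry _).
have RBA_le (M : R) : (forall s, (RBA_from R e s <= M%:E)%E) -> (RBA R e <= M%:E)%E.
  by move=> RM; apply: bigmax_le; rewrite ?leNye.
case: (COV R e) bound => [B| |] bound; last by have [] := bound s0.
  (* The additive 3 is absorbed using [ln 2 <= ln n]. *)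
  have log_le : (trunc_log 2 n + 3)%:R <= 4 * ln n%:R / ln 2 :> R.
    have h1 : (trunc_log 2 n)%:R * ln 2 <= ln n%:R :> R.
      rewrite mulr_natl -lnXn // ler_ln ?posrE ?exprn_gt0 ?ltr0n ?(ltnW V1) //.
      by rewrite -natrX ler_nat trunc_logP // ltnW.
    have h2 : ln 2 <= ln n%:R :> R.
      by rewrite ler_ln ?posrE ?ltr0n ?(ltnW V1) // ler_nat.
    by rewrite ler_pdivlMr // natrD mulrDl; lra.
  have : (RBA R e <= (16 * c * B * ln n%:R / (r * ln 2))%:E)%E.
    apply: RBA_le => s; have [F RF] := bound s; rewrite lee_fin => FB.
    apply: le_trans RF _; rewrite lee_fin natrM.
    apply: le_trans (ler_wpM2l (ler0n _ F) log_le) _.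
    rewrite -/n -/r ler_pdivrMr ?mulr_gt0 // in FB.
    rewrite -[leRHS](_ : (4 * ln n%:R / ln 2) * ((B * (4 * c)) / r) = _); last first.
      by field; rewrite !gt_eqF.
    rewrite mulrC ler_pM2l ?divr_gt0 ?mulr_gt0 //.
    by rewrite ler_pdivlMr.
  move: RBA_ge1 RBA_fin; case: (RBA R e) => [b| |] //; rewrite lee_fin => b1 _.
  rewrite lee_fin => bX; have b0 : 0 < b by apply: lt_le_trans b1.
  rewrite inver gt_eqF // -EFinM lee_fin ler_pdivlMr //.
  have k0 : 0 <= ln 2 / (16 * c) * r * (1 / ln n%:R).
    by clearbody r; apply: ltW; do ![apply: divr_gt0 | apply: mulr_gt0].
  apply: le_trans (ler_wpM2l k0 bX) _.
  rewrite le_eqVlt; apply/orP; left; apply/eqP; field.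
  by rewrite !gt_eqF.
(* Infinite cover time: the denominator is finite and positive, so the ratio is [+oo]. *)
move: RBA_ge1 RBA_fin; case: (RBA R e) => [b| |] //; rewrite lee_fin => b1 _.
have b0 : 0 < b by apply: lt_le_trans b1.
by rewrite inver gt_eqF // gt0_mulye ?lte_fin ?invr_gt0 // leey.
Qed.
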